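(* Let $N\ge 1$ and let $\{\mathbf{x}^{(1)}_m\leftrightarrow\mathbf{x}^{(2)}_m\leftrightarrow\cdots\leftrightarrow\mathbf{x}^{(N)}_m\}_{m=1}^6$ be six correspondences on $N$ images, where $\mathbf{x}^{(n)}_m=[u_{mn},v_{mn}]^T$. For $n\in\{1,\dots,N\}$ and $i_1,i_2,j\in\{1,\dots,6\}$ put $$\xi^{(n)}_{i_1i_2,j}=\begin{vmatrix}u_{i_1n}-u_{jn} & u_{i_2n}-u_{jn}\\ v_{i_1n}-v_{jn} & v_{i_2n}-v_{jn}\end{vmatrix}.$$ Then the $N\times5$ real matrix $\mathbf{\Lambda}$ whose $n$-th row ($n=1,\dots,N$) is $$\begin{bmatrix}\xi^{(n)}_{34,5}\,\xi^{(n)}_{12,6} & \xi^{(n)}_{42,5}\,\xi^{(n)}_{13,6} & \xi^{(n)}_{23,5}\,\xi^{(n)}_{14,6} & \xi^{(n)}_{12,5}\,\xi^{(n)}_{34,6} & \xi^{(n)}_{13,5}\,\xi^{(n)}_{42,6}\end{bmatrix}$$ has rank at most $4$.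
   Context: All quantities are real. World points are $\mathbf{X}_m=[x_m,y_m,z_m]^T\in\mathbb{R}^3$, and an image is described by a $3\times4$ real projection matrix. A projection matrix $\mathbf{P}$ maps the world point $\mathbf{X}_m$ to the image point $\mathbf{x}=[u,v]^T\in\mathbb{R}^2$ if $$\mathbf{P}\begin{bmatrix}\mathbf{X}_m\\1\end{bmatrix}=\begin{bmatrix}\omega u\\ \omega v\\ \omega\end{bmatrix}$$ for some nonzero scale $\omega\in\mathbb{R}$ (which may depend on the point and on the image). ''$\{\mathbf{x}^{(1)}_m\leftrightarrow\cdots\leftrightarrow\mathbf{x}^{(N)}_m\}_{m=1}^6$ are six correspondences on $N$ images'' means: there exist world points $\mathbf{X}_1,\dots,\mathbf{X}_6\in\mathbb{R}^3$ and projection matrices $\mathbf{P}_1,\dots,\mathbf{P}_N\in\mathbb{R}^{3\times4}$ such that $\mathbf{P}_n$ maps $\mathbf{X}_m$ to $\mathbf{x}^{(n)}_m$ for all $m\in\{1,\dots,6\}$ and $n\in\{1,\dots,N\}$. *)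

(* Defs.v *)
From mathcomp Require Import all_boot all_order all_algebra.
From mathcomp Require Import reals.

Set Implicit Arguments.
Unset Strict Implicit.
Unset Printing Implicit Defensive.

Import Order.TTheory GRing.Theory Num.Theory.
Local Open Scope ring_scope.

Definition maps_to (R : realType) (P : 'M[R]_(3, 4)) (X : 'cV[R]_3)
    (x : 'cV[R]_2) : Prop :=
  exists2 w : R, w != 0 &
    P *m (col_mx X 1%:M : 'cV[R]_4) = col_mx (w *: x) w%:M.

(* [x n m] is the image of the [m]-th point on the [n]-th image. *)
Definition six_correspondences (R : realType) (N : nat)
    (x : 'I_N -> 'I_6 -> 'cV[R]_2) : Prop :=
  exists (X : 'I_6 -> 'cV[R]_3) (P : 'I_N -> 'M[R]_(3, 4)),
    forall (m : 'I_6) (n : 'I_N), maps_to (P n) (X m) (x n m).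

(* The points are numbered from 1: for [1 <= k <= 6], [pt k] is the element
   [k - 1] of ['I_6]. *)
Definition pt (k : nat) : 'I_6 := inord k.-1.

Definition xi (R : realType) (x : 'I_6 -> 'cV[R]_2) (i1 i2 j : nat) : R :=
  \det (row_mx (x (pt i1) - x (pt j)) (x (pt i2) - x (pt j)) : 'M[R]_2).

Definition Lambda_row (R : realType) (x : 'I_6 -> 'cV[R]_2) : 'rV[R]_5 :=
  \row_(k < 5)
    [:: xi x 3 4 5 * xi x 1 2 6;
        xi x 4 2 5 * xi x 1 3 6;
        xi x 2 3 5 * xi x 1 4 6;
        xi x 1 2 5 * xi x 3 4 6;
        xi x 1 3 5 * xi x 4 2 6]`_k.

Definition Lambda (R : realType) (N : nat) (x : 'I_N -> 'I_6 -> 'cV[R]_2) :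
    'M[R]_(N, 5) :=
  \matrix_(n < N) Lambda_row (x n).

(* Main.v *)
(** A camera [P] sends [a, b, c] to three points whose bracket is
    [<plane a b c, plane P1 P2 P3>], where [P1, P2, P3] are the rows of [P] and
    [plane P1 P2 P3] is the camera center. Up to the product of the six scales,
    each row of [Lambda] therefore lists the values at the camera center of five
    quadrics (pairs of planes), each of which passes through all six world
    points. If the six points impose independent conditions on the
    10-dimensional space of quadrics, the five quadrics lie in a space of
    dimension 4. For arbitrary points, join the configuration by a line to one
    which does impose independent conditions: the bound holds over the function
    field of that line, and ranks can only drop under specialisation. *)
Require Import Defs.
From mathcomp Require Import all_boot all_order all_algebra.
From mathcomp Require Import reals ring.

Set Implicit Arguments.
Unset Strict Implicit.
Unset Printing Implicit Defensive.

Import Order.TTheory GRing.Theory Num.Theory.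
Local Open Scope ring_scope.

(** * Rank of a polynomial matrix under specialisation *)

(** Truncated inverses of the outer factors of the Gaussian decomposition certify the rank by an
    identity that lifts to polynomials. *)
Lemma mxrank_factor1 (K : fieldType) m n (A : 'M[K]_(m, n)) :
  exists (L : 'M_(\rank A, m)) (M : 'M_(n, \rank A)), L *m A *m M = 1%:M.
Proof.
exists (pid_mx (\rank A) *m invmx (col_ebase A)).
exists (invmx (row_ebase A) *m pid_mx (\rank A)).
set L := pid_mx _ *m _; set M := invmx _ *m _.
have -> : L *m A *m M = L *m (col_ebase A *m pid_mx (\rank A) *m row_ebase A) *m M.
  by rewrite mulmx_ebase.
rewrite /L /M !mulmxA mulmxKV ?col_ebase_unit // mulmxK ?row_ebase_unit //.
rewrite !mul_pid_mx.
have le_r_m := rank_leq_row A; have le_r_n := rank_leq_col A.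
by rewrite minnn (minn_idPr le_r_m) minnn (minn_idPr le_r_n) pid_mx_1.
Qed.

(** With [L] and [M] lifted to constants, the determinant of the product is a polynomial with value
    1 at [a], hence nonzero: the product is invertible over the fraction field. *)
Lemma mxrank_horner_le (K : fieldType) m n (A : 'M[{poly K}]_(m, n)) (a : K) :
  (\rank (map_mx (horner_eval a) A) <= \rank (map_mx (@tofrac {poly K}) A))%N.
Proof.
have [L [M LAM]] := mxrank_factor1 (map_mx (horner_eval a) A).
set r := \rank (map_mx (horner_eval a) A) in L M LAM *.
set LAMt := map_mx polyC L *m A *m map_mx polyC M.
have LAMta : map_mx (horner_eval a) LAMt = 1%:M.
  have polyCa p q (B : 'M[K]_(p, q)) : map_mx (horner_eval a) (map_mx polyC B) = B.
    by apply/matrixP=> i j; rewrite !mxE /horner_eval hornerC.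
  by rewrite !map_mxM !polyCa.
have det_neq0 : \det LAMt != 0.
  apply/eqP=> det0; have /eqP[] := oner_neq0 K.
  by rewrite -(det1 K r) -LAMta det_map_mx det0 rmorph0.
have /mxrank_unit <- : map_mx (@tofrac {poly K}) LAMt \in unitmx.
  by rewrite unitmxE det_map_mx unitfE tofrac_eq0.
by rewrite !map_mxM (leq_trans (mxrankM_maxl _ _)) ?mxrankM_maxr.
Qed.

(** The points [a] and [b] may differ, as each specialised rank is bounded by the generic one. *)
Lemma mulmx0_rank_horner (K : fieldType) m n p (A : 'M[{poly K}]_(m, n))
    (B : 'M_(n, p)) (a b : K) : A *m B = 0 ->
  (\rank (map_mx (horner_eval a) A) + \rank (map_mx (horner_eval b) B) <= n)%N.
Proof.
move=> AB0; apply: leq_trans (leq_add (mxrank_horner_le A a)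
  (mxrank_horner_le B b)) (mulmx0_rank_max _).
by rewrite -map_mxM AB0 map_mx0.
Qed.

Lemma det_mx22 (R : comNzRingType) (M : 'M[R]_2) :
  \det M = M 0 0 * M 1 1 - M 0 1 * M 1 0.
Proof.
rewrite (expand_det_row _ 0) !big_ord_recl big_ord0 /cofactor !det_mx11 !mxE.
have -> : lift ord0 ord0 = 1 :> 'I_2 by apply/val_inj.
have l1 (j : 'I_1) : lift 1 j = 0 :> 'I_2 by rewrite (ord1 j); apply/val_inj.
by rewrite l1 /=; ring.
Qed.

Lemma det_row_mx2 (R : comNzRingType) (a b : 'cV[R]_2) :
  \det (row_mx a b : 'M_2) = a 0 0 * b 1 0 - b 0 0 * a 1 0.
Proof.
have rowl k : (row_mx a b : 'M_2) k 0 = a k 0.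
  by rewrite -(row_mxEl a b k 0); congr (row_mx a b _ _); apply/val_inj.
have rowr k : (row_mx a b : 'M_2) k 1 = b k 0.
  by rewrite -(row_mxEr a b k 0); congr (row_mx a b _ _); apply/val_inj.
by rewrite det_mx22 !rowl !rowr.
Qed.

(** * Planes and quadrics through six points *)

Section Quadrics.
Variable R : comNzRingType.
Implicit Types (a b c l m x : 'rV[R]_4) (X : 'I_6 -> 'rV[R]_4).

Definition minor3 a b c (i j k : 'I_4) : R :=
  a 0 i * (b 0 j * c 0 k - b 0 k * c 0 j)
  - a 0 j * (b 0 i * c 0 k - b 0 k * c 0 i)
  + a 0 k * (b 0 i * c 0 j - b 0 j * c 0 i).

(** Triple cross product: [dot (plane a b c) x] is the determinant with rows [x], [a], [b], [c]. By
    duality it also gives the common point of three planes. *)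
Definition plane a b c : 'rV[R]_4 :=
  \row_k [:: minor3 a b c 1 2 3; - minor3 a b c 0 2 3;
             minor3 a b c 0 1 3; - minor3 a b c 0 1 2]`_k.

(** The products [x0 x1] and [x2 x3] follow the squares, so that the points of [frame] only involve
    the first six monomials. *)
Definition veronese x : 'rV[R]_10 :=
  \row_k [:: x 0 0 ^+ 2; x 0 1 ^+ 2; x 0 2 ^+ 2; x 0 3 ^+ 2;
             x 0 0 * x 0 1; x 0 2 * x 0 3; x 0 0 * x 0 2; x 0 0 * x 0 3;
             x 0 1 * x 0 2; x 0 1 * x 0 3]`_k.

(* The coefficients of the quadratic form [l * m] on the monomials listed in
   [veronese]. *)
Definition quadric l m : 'rV[R]_10 :=
  let s i j := l 0 i * m 0 j + l 0 j * m 0 i in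
  \row_k [:: l 0 0 * m 0 0; l 0 1 * m 0 1; l 0 2 * m 0 2; l 0 3 * m 0 3;
             s 0 1; s 2 3; s 0 2; s 0 3; s 1 2; s 1 3]`_k.

Definition dot l x : R :=
  l 0 0 * x 0 0 + l 0 1 * x 0 1 + l 0 2 * x 0 2 + l 0 3 * x 0 3.

Definition bracket_quadric X (i1 i2 i3 j1 j2 j3 : nat) : 'rV[R]_10 :=
  quadric (plane (X (pt i1)) (X (pt i2)) (X (pt i3)))
          (plane (X (pt j1)) (X (pt j2)) (X (pt j3))).

Definition quadrics X : 'M[R]_(5, 10) :=
  \matrix_(k < 5)
    [:: bracket_quadric X 3 4 5 1 2 6; bracket_quadric X 4 2 5 1 3 6;
        bracket_quadric X 2 3 5 1 4 6; bracket_quadric X 1 2 5 3 4 6;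
        bracket_quadric X 1 3 5 4 2 6]`_k.

Definition veronese_mx X : 'M[R]_(6, 10) := \matrix_(i < 6) veronese (X i).

Lemma eq_quadrics X X' : X =1 X' -> quadrics X = quadrics X'.
Proof. by move=> eqX; rewrite /quadrics /bracket_quadric !eqX. Qed.

Lemma quadricE l m x (i j : 'I_1) :
  (quadric l m *m (veronese x)^T) i j = dot l x * dot m x.
Proof.
rewrite mxE !big_ord_recl big_ord0 !mxE /= /dot.
by ring.
Qed.

Lemma mulmx_dot n (A : 'M[R]_(n, 4)) (h : 'cV[R]_4) k :
  (A *m h) k 0 = dot (row k A) h^T.
Proof.
rewrite mxE !big_ord_recl big_ord0 addr0 !addrA /dot !mxE.
have -> : lift ord0 (lift ord0 (lift ord0 ord0)) = 3 :> 'I_4 by apply/val_inj.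
have -> : lift ord0 (lift ord0 ord0) = 2 :> 'I_4 by apply/val_inj.
by have -> : lift ord0 ord0 = 1 :> 'I_4 by apply/val_inj.
Qed.

Lemma dot_plane a b c x :
  [|| x == a, x == b | x == c] -> dot (plane a b c) x = 0.
Proof.
by case/or3P=> /eqP->; rewrite /dot !mxE /= /minor3; ring.
Qed.

(** The two triples of each product partition the six indices, so one of the two planes contains any
    given point. *)
Lemma quadrics_veronese0 X : quadrics X *m (veronese_mx X)^T = 0.
Proof.
apply/matrixP=> k i.
have -> : (quadrics X *m (veronese_mx X)^T) k i =
    (row k (quadrics X) *m (veronese (X i))^T) 0 0.
  by rewrite !mxE; apply: eq_bigr => h _; rewrite !mxE.
rewrite rowK [RHS]mxE.
have -> : i = pt i.+1 by rewrite /pt /= inord_val.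
by case: k i => [[|[|[|[|[|//]]]]] ?] [[|[|[|[|[|[|//]]]]]] ?];
  rewrite quadricE; (rewrite [X in X * _]dot_plane ?eqxx ?orbT // mul0r ||
                     rewrite [X in _ * X]dot_plane ?eqxx ?orbT // mulr0).
Qed.

End Quadrics.

Section MapQuadrics.
Variables (R S : comNzRingType) (f : {rmorphism R -> S}).

Let rmorph_ring := (rmorphB, rmorphN, rmorphD, rmorphM, rmorphXn).

Lemma map_plane (a b c : 'rV[R]_4) :
  map_mx f (plane a b c) = plane (map_mx f a) (map_mx f b) (map_mx f c).
Proof.
by apply/rowP=> -[[|[|[|[|//]]]] ?]; rewrite !mxE /= /minor3 !mxE !rmorph_ring.
Qed.

Lemma map_quadric (l m : 'rV[R]_4) :
  map_mx f (quadric l m) = quadric (map_mx f l) (map_mx f m).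
Proof.
by apply/rowP=> -[[|[|[|[|[|[|[|[|[|[|//]]]]]]]]]] ?];
  rewrite !mxE /= !rmorph_ring.
Qed.

Lemma map_veronese (x : 'rV[R]_4) :
  map_mx f (veronese x) = veronese (map_mx f x).
Proof.
by apply/rowP=> -[[|[|[|[|[|[|[|[|[|[|//]]]]]]]]]] ?];
  rewrite !mxE /= ?mxE !rmorph_ring.
Qed.

Lemma map_quadrics (X : 'I_6 -> 'rV[R]_4) :
  map_mx f (quadrics X) = quadrics (map_mx f \o X).
Proof.
apply/row_matrixP=> k; rewrite -map_row !rowK.
by case: k => -[|[|[|[|[|//]]]]] ? /=; rewrite map_quadric !map_plane.
Qed.

Lemma map_veronese_mx (X : 'I_6 -> 'rV[R]_4) :
  map_mx f (veronese_mx X) = veronese_mx (map_mx f \o X).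
Proof. by apply/row_matrixP=> i; rewrite -map_row !rowK map_veronese. Qed.

End MapQuadrics.

(** * Rank bound for arbitrary points *)

(** The vertices of the coordinate tetrahedron and one point on each of two opposite edges. *)
Definition frame (K : fieldType) (i : 'I_6) : 'rV[K]_4 :=
  \row_k (nth [::] [:: [:: 1; 0; 0; 0]; [:: 0; 1; 0; 0]; [:: 0; 0; 1; 0];
                       [:: 0; 0; 0; 1]; [:: 1; 1; 0; 0]; [:: 0; 0; 1; 1]] i)`_k.

(* The [j]-th column of [B] is a quadratic form equal to 1 at the [j]-th point
   of [frame] and to 0 at the five others. *)
Lemma veronese_frame_free (K : fieldType) : row_free (veronese_mx (@frame K)).
Proof.
pose B : 'M[K]_(10, 6) := \matrix_(i, j)
  (nth [::] [:: [:: 1]; [:: 0; 1]; [:: 0; 0; 1]; [:: 0; 0; 0; 1];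
                [:: -1; -1; 0; 0; 1]; [:: 0; 0; -1; -1; 0; 1]] i)`_j.
apply/row_freeP; exists B; apply/matrixP=> i j.
rewrite mxE !big_ord_recl big_ord0 !(mxE, nth_nil) /=.
by case: i j => [[|[|[|[|[|[|//]]]]]] ?] [[|[|[|[|[|[|//]]]]]] ?] /=; ring.
Qed.

Lemma rank_quadrics (K : fieldType) (X : 'I_6 -> 'rV[K]_4) :
  (\rank (quadrics X) <= 4)%N.
Proof.
(* The line from [X] (at 0) to [frame] (at 1). *)
pose Xt i := map_mx polyC (X i) + 'X *: map_mx polyC (@frame K i - X i).
have XtE a i : map_mx (horner_eval a) (Xt i) = X i + a *: (@frame K i - X i).
  by apply/rowP=> k; rewrite !mxE /horner_eval !hornerE.
have := mulmx0_rank_horner 0 1 (quadrics_veronese0 Xt).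
rewrite -map_trmx mxrank_tr map_quadrics map_veronese_mx.
have -> : quadrics (map_mx (horner_eval 0) \o Xt) = quadrics X.
  by apply: eq_quadrics => i /=; rewrite XtE scale0r addr0.
have -> : veronese_mx (map_mx (horner_eval 1) \o Xt) = veronese_mx (@frame K).
  by apply/row_matrixP=> i; rewrite !rowK /= XtE scale1r addrC subrK.
(* The Veronese matrix has rank 6 at 1, which leaves 10 - 6 = 4. *)
by rewrite (eqP (veronese_frame_free K)) (leq_add2r 6 _ 4).
Qed.

(** * From image brackets to quadrics *)

(** Cauchy-Binet: the right-hand side is a 3 by 3 determinant of pairings. *)
Lemma dot_plane_plane (R : comNzRingType) (a b c p q r : 'rV[R]_4) :
  dot (plane a b c) (plane p q r) =
    dot p a * (dot q b * dot r c - dot q c * dot r b)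
    - dot p b * (dot q a * dot r c - dot q c * dot r a)
    + dot p c * (dot q a * dot r b - dot q b * dot r a).
Proof. by rewrite /dot !mxE /= /minor3; ring. Qed.

Section Image.
Variables (R : realType) (P : 'M[R]_(3, 4)) (X : 'I_6 -> 'cV[R]_3).
Variables (x : 'I_6 -> 'cV[R]_2) (w : 'I_6 -> R).
Hypothesis PX : forall m,
  P *m (col_mx (X m) 1%:M : 'cV[R]_4) = col_mx (w m *: x m) (w m)%:M.

Let hX m : 'rV[R]_4 := (col_mx (X m) 1%:M)^T.
Let center := plane (row 0 P) (row 1 P) (row 2 P).

Lemma dot_row k m :
  dot (row k P) (hX m) = (col_mx (w m *: x m) (w m)%:M : 'cV[R]_3) k 0.
Proof. by rewrite -PX mulmx_dot. Qed.

(** The determinant has columns [w * (u, v, 1)]; subtracting the column of [j], once the scales are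
    factored out, leaves [xi]. *)
Lemma xi_dot i1 i2 j :
  dot (plane (hX (pt i1)) (hX (pt i2)) (hX (pt j))) center =
    w (pt i1) * w (pt i2) * w (pt j) * xi x i1 i2 j.
Proof.
have dotu m (k : 'I_2) : dot (row (lshift 1 k) P) (hX m) = w m * x m k 0.
  by rewrite dot_row; apply: etrans (col_mxEu _ _ _ _) _; rewrite mxE.
have dot0 m : dot (row 0 P) (hX m) = w m * x m 0 0.
  by rewrite -dotu; congr (dot (row _ P) _); apply/val_inj.
have dot1 m : dot (row 1 P) (hX m) = w m * x m 1 0.
  by rewrite -dotu; congr (dot (row _ P) _); apply/val_inj.
have dot2 m : dot (row 2 P) (hX m) = w m.
  have -> : row 2 P = row (rshift 2 (0 : 'I_1)) P by congr row; apply/val_inj.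
  by rewrite dot_row; apply: etrans (col_mxEd _ _ _ _) _; rewrite mxE.
by rewrite dot_plane_plane !dot0 !dot1 !dot2 /xi det_row_mx2 !mxE; ring.
Qed.

Lemma bracket_quadric_xi i1 i2 i3 j1 j2 j3 :
  (bracket_quadric hX i1 i2 i3 j1 j2 j3 *m (veronese center)^T) 0 0 =
    w (pt i1) * w (pt i2) * w (pt i3) * (w (pt j1) * w (pt j2) * w (pt j3))
    * (xi x i1 i2 i3 * xi x j1 j2 j3).
Proof. by rewrite quadricE !xi_dot; ring. Qed.

Lemma Lambda_row_sub :
  (forall m, w m != 0) -> (Lambda_row x <= (quadrics hX)^T)%MS.
Proof.
(* Each entry uses every point exactly once, so all five share the factor [W]. *)
move=> w_neq0; pose W := \prod_(k < 6) w (pt k.+1).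
have W_neq0 : W != 0 by apply/prodf_neq0.
suff -> : Lambda_row x = W^-1 *: (veronese center *m (quadrics hX)^T).
  by rewrite scalemx_sub ?submxMl.
apply: (canRL (scalerK W_neq0)); apply/rowP=> k.
have -> : (veronese center *m (quadrics hX)^T) 0 k =
    (row k (quadrics hX) *m (veronese center)^T) 0 0.
  by rewrite !mxE; apply: eq_bigr => h _; rewrite !mxE mulrC.
rewrite rowK mxE [Lambda_row _ _ _]mxE /W !big_ord_recl big_ord0 /=.
by case: k => -[|[|[|[|[|//]]]]] ? /=; rewrite bracket_quadric_xi /bump /=; ring.
Qed.

End Image.

Theorem theorem2 (R : realType) (N : nat) (x : 'I_N -> 'I_6 -> 'cV[R]_2)
    (hN : (1 <= N)%N) (hx : six_correspondences x) :
  (\rank (Lambda x) <= 4)%N.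
Proof.
case: hx => X [P PX]; pose hX m : 'rV[R]_4 := (col_mx (X m) 1%:M)^T.
(* The quadrics depend only on the world points, so one row space contains the rows of all
   images. *)
apply: leq_trans (rank_quadrics hX); rewrite -(mxrank_tr (quadrics _)) mxrankS //.
apply/row_subP=> n; rewrite rowK.
have [w w_neq0 Pw] := @fin_all_exists2 _ _ _ _ (fun m => PX m n).
exact: Lambda_row_sub Pw w_neq0.
Qed.
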